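(* Let $\mathfrak{A}$ be a unital $C^*$-algebra and $a\in\mathfrak{A}$. Then $$dw_{\mathfrak{A}}^2(a)\geq\frac{1}{2}\sup_{\theta\in\mathbb{R}}\left(w_{\mathfrak{A}}^2(e^{i\theta}a+a^*a)+\mathfrak{C}^2(e^{i\theta}a-a^*a)\right),$$ where $\mathfrak{C}(e^{i\theta}a-a^*a)$ is the Crawford number of $e^{i\theta}a-a^*a$.
   Context: $\mathfrak{A}$ is a complex, nonzero, unital $C^*$-algebra with unit $\boldsymbol{1}$; its state space $\mathfrak{S}(\mathfrak{A})$ is the set of all positive linear functionals $f\in\mathfrak{A}^*$ with $\|f\|=f(\boldsymbol{1})=1$. For $b\in\mathfrak{A}$: the algebraic numerical radius is $w_{\mathfrak{A}}(b)=\sup\{|f(b)|:f\in\mathfrak{S}(\mathfrak{A})\}$; the Crawford number is $\mathfrak{C}(b)=\inf\{|f(b)|:f\in\mathfrak{S}(\mathfrak{A})\}$; the algebraic Davis--Wielandt radius is $dw_{\mathfrak{A}}(b)=\sup\{\sqrt{|f(b)|^2+f(b^*b)^2}:f\in\mathfrak{S}(\mathfrak{A})\}$. The superscript $2$ on $dw_{\mathfrak{A}}$, $w_{\mathfrak{A}}$, $\mathfrak{C}$ denotes the square of the value. *)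

(* Defs.v *)
From HB Require Import structures.
From mathcomp Require Import all_boot all_order all_algebra.
From mathcomp Require Import complex.
From mathcomp Require Import all_classical all_reals all_analysis.
Set Implicit Arguments.
Unset Strict Implicit.
Unset Printing Implicit Defensive.
Import Order.TTheory GRing.Theory Num.Theory.
Import numFieldNormedType.Exports.
Import Normc.
Local Open Scope classical_set_scope.
Local Open Scope ring_scope.
Local Open Scope complex_scope.

(* The hierarchy has no join of normed modules and rings (other than
   numDomainType), so the multiplication is part of the mixin; the algType
   structure is recovered as canonical instances below.
   The norm of a normed module over R[i] is valued in R[i] (its values are real
   and nonnegative there), so [cstar_normM] and [cstar_normE] live in R[i]. *)
HB.mixin Record isCStarAlgebra (R : realType) A
    & CompleteNormedModule R[i] A := {
  cstar_one : A;
  cstar_mul : A -> A -> A;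
  star : A -> A;
  cstar_mulA : associative cstar_mul;
  cstar_mul1 : left_id cstar_one cstar_mul;
  cstar_mulr1 : right_id cstar_one cstar_mul;
  cstar_mulDl : left_distributive cstar_mul +%R;
  cstar_mulDr : right_distributive cstar_mul +%R;
  cstar_scaleAl : forall (c : R[i]) x y,
    c *: cstar_mul x y = cstar_mul (c *: x) y;
  cstar_scaleAr : forall (c : R[i]) x y,
    c *: cstar_mul x y = cstar_mul x (c *: y);
  cstar_oner_neq0 : cstar_one != 0;
  cstar_normM : forall x y, `|cstar_mul x y| <= `|x| * `|y|;
  starK : involutive star;
  starD : forall x y, star (x + y) = star x + star y;
  starZ : forall (c : R[i]) x, star (c *: x) = c^* *: star x;
  cstar_starM : forall x y,
    star (cstar_mul x y) = cstar_mul (star y) (star x);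
  cstar_normE : forall x, `|cstar_mul (star x) x| = `|x| ^+ 2
}.

#[short(type="cstarAlgType")]
HB.structure Definition CStarAlgebra (R : realType) :=
  {A of CompleteNormedModule R[i] A & isCStarAlgebra R A}.

#[non_forgetful_inheritance]
HB.instance Definition _ (R : realType) (A : cstarAlgType R) :=
  GRing.Zmodule_isNzRing.Build (CStarAlgebra.sort A)
    (@cstar_mulA R A) (@cstar_mul1 R A) (@cstar_mulr1 R A)
    (@cstar_mulDl R A) (@cstar_mulDr R A) (@cstar_oner_neq0 R A).
#[non_forgetful_inheritance]
HB.instance Definition _ (R : realType) (A : cstarAlgType R) :=
  GRing.Lmodule_isLalgebra.Build R[i] (CStarAlgebra.sort A)
    (@cstar_scaleAl R A).
#[non_forgetful_inheritance]
HB.instance Definition _ (R : realType) (A : cstarAlgType R) :=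
  GRing.Lalgebra_isAlgebra.Build R[i] (CStarAlgebra.sort A)
    (@cstar_scaleAr R A).

Section States.
Context {R : realType} {A : cstarAlgType R}.
Implicit Types (f : {scalar A}) (b : A).

Definition cstar_positive b := exists x, b = star x * x.

Definition positive_functional f :=
  forall b, cstar_positive b -> 0 <= f b.

Definition functional_norm f : R :=
  sup [set normc (f b) | b in [set b | `|b| <= 1]].

(* Continuity is required separately because the real-valued [sup] takes the
   default value 0 on unbounded sets. *)
Definition is_state f :=
  [/\ continuous (f : A -> R[i]^o), positive_functional f,
      functional_norm f = 1 & f 1 = 1].

Definition state_space : set {scalar A} := [set f | is_state f].

Definition num_radius b : R :=
  sup [set normc (f b) | f in state_space].

Definition crawford b : R :=
  inf [set normc (f b) | f in state_space].

(* [f (star b * b)] is a nonnegative real for a state [f]; [complex.Re] only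
   moves it from R[i] to R. *)
Definition davis_wielandt b : R :=
  sup [set Num.sqrt (normc (f b) ^+ 2 + complex.Re (f (star b * b)) ^+ 2)
      | f in state_space].

End States.

Definition cexpi {R : realType} (t : R) : R[i] := cos t +i* sin t.

(* Main.v *)
Require Import Defs.
From mathcomp Require Import all_boot all_order all_algebra.
From mathcomp Require Import complex.
From mathcomp Require Import all_classical all_reals all_analysis.
From mathcomp Require Import ring.
Import Order.TTheory GRing.Theory Num.Theory.
Local Open Scope classical_set_scope.
Local Open Scope ring_scope.

(** For a state f and |u| = 1, f(a^* a) is real, so the parallelogram law
    |u f(a) + f(a^* a)|^2 + |u f(a) - f(a^* a)|^2
      = 2 (|f(a)|^2 + f(a^* a)^2)
    bounds its left-hand side by 2 dw(a)^2.  The second term on the left is at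
    least the squared Crawford number, whatever f is; taking the supremum over
    f in the first term, and then over u, gives the inequality. *)

(** Any element of [S] lies between 0 and [sup S]; for an empty or unbounded [S], [sup] has the
    default value 0. *)
Lemma sup_ge0 (R : realType) (S : set R) :
  (forall x, S x -> 0 <= x) -> 0 <= sup S.
Proof.
move=> S_ge0; have [supS|/sup_out ->] := pselect (has_sup S); last exact: lexx.
have [[x Sx] ubS] := supS; exact: le_trans (S_ge0 x Sx) (ub_le_sup ubS Sx).
Qed.

Section States.
Context {R : realType} {A : cstarAlgType R}.
Implicit Types (f : {scalar A}) (a b : A).

Lemma normc_ge0 (z : R[i]) : 0 <= Normc.normc z.
Proof. by case: z => x y; exact: sqrtr_ge0. Qed.

(** Scaling a nonzero [b] to norm one brings it into the unit ball, where [functional_norm f = 1]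
    bounds [f]. This makes the suprema over states below finite. *)
Lemma normc_state_le f b : is_state f -> Normc.normc (f b) <= complex.Re `|b|.
Proof.
move=> [_ _ norm_f _].
(* [sup] is 0 on sets without supremum, so [functional_norm f = 1] already
   forces boundedness. *)
have bnd_f : has_sup [set Normc.normc (f b) | b in [set b | `|b| <= 1]].
  apply: contrapT => /sup_out sup0.
  by move: norm_f; rewrite /functional_norm sup0 => /esym/eqP; rewrite oner_eq0.
have [->|b0] := eqVneq b 0.
  by rewrite linear0 normr0 Normc.normc0.
have nb0 : `|b| != 0 by rewrite normr_eq0.
have : Normc.normc (f (`|b|^-1 *: b)) <= 1.
  rewrite -[leRHS]norm_f; apply: ub_le_sup; first by case: bnd_f.
  exists (`|b|^-1 *: b) => //=.
  by rewrite normrZ normfV normr_id mulVf.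
rewrite linearZ /= -lecR.
have -> : (Normc.normc (`|b|^-1 * f b))%:C%C = `| `|b|^-1 * f b| by [].
rewrite normrM normfV normr_id ler_pdivrMl ?normr_gt0 // mulr1 => fb_le.
by rewrite -lecR RRe_real ?normr_real.
Qed.

Lemma crawford_le f b : is_state f -> crawford b <= Normc.normc (f b).
Proof.
move=> sf; apply: ge_inf; last by exists f.
by exists 0 => _ [g _ <-]; exact: normc_ge0.
Qed.

Lemma crawford_ge0 b : 0 <= crawford b.
Proof.
have [S0|S0] := eqVneq [set Normc.normc (f b) | f in @state_space R A] set0.
  by rewrite /crawford S0 inf0.
apply: lb_le_inf; first exact/set0P.
by move=> _ [g _ <-]; exact: normc_ge0.
Qed.

Lemma state_starM_real f a : is_state f ->
  f (star a * a) = (complex.Re (f (star a * a)))%:C%C.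
Proof.
move=> [_ pos_f _ _]; rewrite RRe_real // ger0_real //.
by apply: pos_f; exists a.
Qed.

Lemma Re_le_normc (z : R[i]) : `|complex.Re z| <= Normc.normc z.
Proof. by rewrite -lecR; exact: normc_ge_Re. Qed.

Lemma sqr_le_davis_wielandt f a : is_state f ->
  Normc.normc (f a) ^+ 2 + complex.Re (f (star a * a)) ^+ 2
  <= davis_wielandt a ^+ 2.
Proof.
move=> sf; have sum_ge0 g :
    0 <= Normc.normc (g a : R[i]) ^+ 2 + complex.Re (g (star a * a) : R[i]) ^+ 2.
  by rewrite addr_ge0 ?sqr_ge0.
rewrite -[leLHS]sqr_sqrtr //; apply: lerXn2r; rewrite ?nnegrE ?sqrtr_ge0 //.
  by apply: sup_ge0 => _ [g _ <-]; exact: sqrtr_ge0.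
apply: ub_le_sup; last by exists f.
(* By [normc_state_le] at [a] and at [star a * a], this bounds the set from above, so [sup] is a
   true supremum and not its default 0. *)
exists (Num.sqrt (complex.Re `|a| ^+ 2 + complex.Re `|star a * a| ^+ 2)).
move=> _ [g sg <-]; rewrite ler_wsqrtr // lerD //.
  rewrite lerXn2r ?nnegrE ?normc_ge0 ?normc_state_le //.
  exact: le_trans (normc_ge0 _) (normc_state_le g a sg).
rewrite -[leLHS]real_normK ?num_real // lerXn2r ?nnegrE //.
  exact: le_trans (normc_ge0 _) (normc_state_le g _ sg).
exact: le_trans (Re_le_normc _) (normc_state_le g _ sg).
Qed.

Lemma normc_sqrE (x y : R) : Normc.normc (x +i* y)%C ^+ 2 = x ^+ 2 + y ^+ 2.
Proof. by rewrite /= sqr_sqrtr // addr_ge0 ?sqr_ge0. Qed.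

(** In coordinates the cross terms cancel, and [cexpi t] enters only through its squared modulus,
    which is 1. *)
Lemma normc_parallelogram (t r : R) (z : R[i]) :
  Normc.normc (cexpi t * z + r%:C%C) ^+ 2
    + Normc.normc (cexpi t * z - r%:C%C) ^+ 2
  = 2 * (Normc.normc z ^+ 2 + r ^+ 2).
Proof.
case: z => x y; rewrite /cexpi /real_complex_def !normc_sqrE.
have := cos2Dsin2 t; set c := cos t; set s := sin t => cs1.
transitivity (2 * ((c ^+ 2 + s ^+ 2) * (x ^+ 2 + y ^+ 2) + r ^+ 2)); first ring.
by rewrite cs1 mul1r.
Qed.

Lemma num_radius_crawford_le a (t : R) :
  num_radius (cexpi t *: a + star a * a) ^+ 2
    + crawford (cexpi t *: a - star a * a) ^+ 2 <= 2 * davis_wielandt a ^+ 2.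
Proof.
set b := cexpi t *: a + _; set b' := cexpi t *: a - _.
(* No state is constructed here, so an empty state space is treated apart: [sup] and [inf] are then
   0 and the left-hand side vanishes. *)
have [S0|/set0P[f0 sf0]] := eqVneq (@state_space R A) set0.
  rewrite /num_radius /crawford S0 !image_set0 sup0 inf0 !expr0n /= addr0.
  by rewrite mulr_ge0 ?sqr_ge0.
have bound f : is_state f ->
    Normc.normc (f b) ^+ 2 + crawford b' ^+ 2 <= 2 * davis_wielandt a ^+ 2.
  move=> sf; apply: (@le_trans _ _
    (Normc.normc (f b) ^+ 2 + Normc.normc (f b') ^+ 2)).
    by rewrite lerD2l lerXn2r ?nnegrE ?crawford_ge0 ?normc_ge0 ?crawford_le.
  rewrite linearD linearB linearZ /= (state_starM_real f a sf).
  rewrite normc_parallelogram ler_pM2l //; exact: sqr_le_davis_wielandt.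
rewrite -lerBrDr.
(* The state [f0] shows that the right-hand side is nonnegative, hence the square of its root; it
   then suffices to bound each [normc (f b)] by that root. *)
have D0 : 0 <= 2 * davis_wielandt a ^+ 2 - crawford b' ^+ 2.
  by rewrite (le_trans (sqr_ge0 (Normc.normc (f0 b)))) // lerBrDr bound.
rewrite -[leRHS]sqr_sqrtr // lerXn2r ?nnegrE ?sqrtr_ge0 //.
  by apply: sup_ge0 => _ [g _ <-]; exact: normc_ge0.
apply: ge_sup; first by exists (Normc.normc (f0 b)), f0.
move=> _ [f sf <-]; rewrite -[leLHS]ger0_norm ?normc_ge0 //.
by rewrite -sqrtr_sqr ler_wsqrtr // lerBrDr bound.
Qed.

End States.

Theorem theorem3p14 (R : realType) (A : cstarAlgType R) (a : A) :
  davis_wielandt a ^+ 2 >=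
  1 / 2 * sup [set num_radius (cexpi theta *: a + star a * a) ^+ 2
                   + crawford (cexpi theta *: a - star a * a) ^+ 2
              | theta in [set: R]].
Proof.
rewrite div1r ler_pdivrMl //; apply: ge_sup.
  by apply: image_nonempty; exists 0.
by move=> _ [t _ <-]; exact: num_radius_crawford_le.
Qed.
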